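(* The field of Euclidean constructible numbers $\mathcal{E}$ is the smallest subset of constructible points in the complex numbers $\mathbb{C}$, which contains the numbers $0$ and $1$, and is closed under the axioms: ($\alpha$) The point of coincidence of two constructible lines is a constructible point. ($\beta$) The perpendicular bisector of the segment connecting two constructible points is a constructible line. ($\gamma$) Given a constructed line $l$ and constructed points $P,Q$, then whenever possible, the line through $Q$, which reflects $P$ onto $l$, can be constructed.
   Context: All constructions take place in the plane of the complex numbers $\mathbb{C}$. Starting from the points $0$ and $1$, the axioms produce constructible (constructed) points and constructible (constructed) lines; the points on a constructed line are not necessarily constructible points. A line reflects $P$ onto $l$ if the mirror image of $P$ in that line lies on $l$. The field of Euclidean constructible numbers $\mathcal{E}$ is the set of constructible points obtained, beginning with the set containing just $0$ and $1$, using the following axioms: (1) The line connecting two constructible points is a constructible line. (2) The point of coincidence of two constructible lines is a constructible point. (3) The perpendicular bisector of the segment connecting two constructible points is a constructible line. (4) The line bisecting any given constructed angle can be constructed. (5) Given a constructed line $l$ and constructed points $P,Q$, then whenever possible, the line through $Q$, which reflects $P$ onto $l$, can be constructed. Thus ($\alpha$), ($\beta$), ($\gamma$) are the axioms (2), (3), (5). *)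

(* Defs.v *)
From mathcomp Require Import all_boot all_order all_algebra.
From mathcomp Require Import boolp classical_sets reals.
From mathcomp Require Export complex.

Set Implicit Arguments.
Unset Strict Implicit.
Unset Printing Implicit Defensive.

Import GRing.Theory Num.Theory.
Local Open Scope ring_scope.
Local Open Scope complex_scope.
Local Open Scope classical_set_scope.

Section PlaneGeometry.
Variable R : realType.
Local Notation C := R[i].
Implicit Types (A B P Q : C) (l m b : set C).

Definition line_dir A (d : C) : set C := [set A + t%:C * d | t in [set: R]].

Definition is_line l : Prop := exists A (d : C), d != 0 /\ l = line_dir A d.

(* A line only when P <> Q, and likewise for the perpendicular bisector. *)
Definition line_through P Q : set C := line_dir P (Q - P).

Definition perp_bisector P Q : set C :=
  line_dir ((P + Q) / 2%:R) ('i * (Q - P)).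

Definition mirror_image m P P' : Prop :=
  is_line m /\ ((P' = P /\ P \in m) \/ (P' <> P /\ m = perp_bisector P P')).

Definition reflects_onto m P l : Prop :=
  exists P', mirror_image m P P' /\ P' \in l.

Definition coincidence l m P : Prop := [/\ l <> m, P \in l & P \in m].

Definition ray A B : set C := [set A + t%:C * (B - A) | t in [set t : R | 0 <= t]].

(* b is the bisector of the angle BAC, with vertex A and arms ray A B, ray A C. *)
Definition bisects b B A C' : Prop :=
  [/\ is_line b, A \in b &
      [set Y | exists2 X, X \in ray A B & mirror_image b X Y] = ray A C'].

(* m is a line through Q reflecting P onto l; there may be none, one or two.
   When P = Q lies on l, every line through Q satisfies the reflection
   condition, so no line is determined and the construction is not possible. *)
Definition fold_line l P Q m : Prop :=
  [/\ ~ (P = Q /\ Q \in l), is_line m, Q \in m & reflects_onto m P l].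

End PlaneGeometry.

Section Constructions.
Variable R : realType.
Local Notation C := R[i].

(* In euclid_bisector the points B and C' only serve to select the arms of an
   angle formed by two constructed lines; they need not be constructible. *)
Inductive euclid_point : C -> Prop :=
| euclid_0 : euclid_point 0
| euclid_1 : euclid_point 1
| euclid_coincidence (l m : set C) (P : C) :
    euclid_line l -> euclid_line m -> coincidence l m P -> euclid_point P
with euclid_line : set C -> Prop :=
| euclid_connect (P Q : C) :
    euclid_point P -> euclid_point Q -> P <> Q ->
    euclid_line (line_through P Q)
| euclid_perp_bisector (P Q : C) :
    euclid_point P -> euclid_point Q -> P <> Q ->
    euclid_line (perp_bisector P Q)
| euclid_bisector (l m b : set C) (A B C' : C) :
    euclid_line l -> euclid_line m -> euclid_point A ->
    A \in l -> A \in m -> B \in l -> C' \in m -> B <> A -> C' <> A ->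
    bisects b B A C' -> euclid_line b
| euclid_fold (l m : set C) (P Q : C) :
    euclid_line l -> euclid_point P -> euclid_point Q ->
    fold_line l P Q m -> euclid_line m.

Definition Euclidean_numbers : set C := [set P | euclid_point P].

(* S is the set of constructible points, L the set of constructible lines. *)
Definition axiom_alpha (S : set C) (L : set (set C)) : Prop :=
  forall l m P, l \in L -> m \in L -> coincidence l m P -> P \in S.

Definition axiom_beta (S : set C) (L : set (set C)) : Prop :=
  forall P Q, P \in S -> Q \in S -> P <> Q -> perp_bisector P Q \in L.

Definition axiom_gamma (S : set C) (L : set (set C)) : Prop :=
  forall l P Q m, l \in L -> P \in S -> Q \in S -> fold_line l P Q m -> m \in L.

(* It is the same to require this for the least L satisfying beta and gamma
   with S, the lines constructible from S: alpha is antitone in L. *)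
Definition closed_alpha_beta_gamma (S : set C) : Prop :=
  exists L : set (set C),
    [/\ forall l, l \in L -> is_line l,
        axiom_alpha S L, axiom_beta S L & axiom_gamma S L].

End Constructions.

Arguments Euclidean_numbers R : clear implicits.

(* Main.v *)
(** Let [S] and [L] be points and lines closed under the three axioms.  For
    distinct points [P], [Q] of [S], folding [P] through [Q] onto the
    perpendicular bisector of [PQ] produces the two lines through [Q] at
    30 degrees to [PQ], since [P] lands on the apex of an equilateral triangle.
    Hence every point of [S] lies on a line of [L], and folding [Q], which is on
    such a line, through [P] gives the line [PQ].  Moreover one of the two
    30 degree lines is not parallel to a given line of [L], so every line of [L]
    through a point [A] of [S] has a further point [P] in [S].  Reflecting [P]
    through [A] onto the other arm of an angle gives the bisector. *)

Require Import Defs.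
From mathcomp Require Import all_boot all_order all_algebra.
From mathcomp Require Import boolp classical_sets reals.
From mathcomp Require Import ring.
Local Open Scope ring_scope.
Local Open Scope classical_set_scope.

Import Order.TTheory GRing.Theory Num.Theory.

Scheme euclid_point_mind := Minimality for euclid_point Sort Prop
  with euclid_line_mind := Minimality for euclid_line Sort Prop.
Combined Scheme euclid_mind from euclid_point_mind, euclid_line_mind.

Section Lines.
Set Implicit Arguments.
Unset Strict Implicit.
Local Open Scope complex_scope.
Variable R : realType.
Local Notation C := R[i].
Implicit Types (A B P Q d : C) (l m b : set C) (k s t : R).

(** * Complex arithmetic and lines in parametric form *)

Lemma mulii : 'i * 'i = -1 :> C.
Proof. by rewrite -expr2 sqr_i. Qed.

Lemma complexi_neq0 : 'i != 0 :> C.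
Proof. by rewrite eq_complex /= oner_eq0 andbF. Qed.

Lemma complexC_eq0 s t : s%:C + t%:C * 'i = 0 :> C -> s = 0 /\ t = 0.
Proof. by simpc => -[-> ->]. Qed.

Lemma complexC_half : (2^-1)%:C = 2^-1 :> C.
Proof. by rewrite fmorphV rmorph_nat. Qed.

Lemma set_mem_eq l m : (forall P, P \in l <-> P \in m) -> l = m.
Proof. by move=> H; apply/seteqP; split=> P /mem_set/H/set_mem. Qed.

Lemma line_dirP A d P : P \in line_dir A d <-> exists t, P = A + t%:C * d.
Proof.
rewrite in_setE; split; first by case=> t _ <-; exists t.
by case=> t ->; exists t.
Qed.

Lemma line_dir_base A d : A \in line_dir A d.
Proof. by apply/line_dirP; exists 0; rewrite mul0r addr0. Qed.

Lemma line_dir_rebase A d P : P \in line_dir A d -> line_dir P d = line_dir A d.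
Proof.
case/line_dirP=> s ->; apply: set_mem_eq => X; split.
  by case/line_dirP=> t ->; apply/line_dirP; exists (s + t); ring.
by case/line_dirP=> t ->; apply/line_dirP; exists (t - s); ring.
Qed.

Lemma line_dirZ A d s : s != 0 -> line_dir A (s%:C * d) = line_dir A d.
Proof.
move=> s0; apply: set_mem_eq => X; split.
  by case/line_dirP=> t ->; apply/line_dirP; exists (t * s); ring.
case/line_dirP=> t ->; apply/line_dirP; exists (t / s).
by rewrite mulrA -rmorphM /= divfK.
Qed.

Lemma is_line_dir A d : d != 0 -> is_line (line_dir A d).
Proof. by move=> d0; exists A, d. Qed.

Lemma is_line_rebase l A : is_line l -> A \in l ->
  exists2 d, d != 0 & l = line_dir A d.
Proof. by case=> B [d [d0 ->]] /line_dir_rebase <-; exists d. Qed.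

Lemma is_line_eq l A B : is_line l -> A \in l -> B \in l -> B <> A ->
  l = line_dir A (B - A).
Proof.
move=> ll Al; have [d d0 ->] := is_line_rebase ll Al.
case/line_dirP=> t -> BA; rewrite addrAC subrr add0r line_dirZ //.
by apply/eqP=> t0; apply: BA; rewrite t0 mul0r addr0.
Qed.

Lemma is_line_through P Q : P <> Q -> is_line (line_through P Q).
Proof. by move=> /eqP PQ; apply: is_line_dir; rewrite subr_eq0 eq_sym. Qed.

Lemma is_line_perp_bisector P Q : P <> Q -> is_line (perp_bisector P Q).
Proof.
move=> /eqP PQ; apply: is_line_dir; apply: mulf_neq0.
  exact: complexi_neq0.
by rewrite subr_eq0 eq_sym.
Qed.

(** * Perpendicular bisectors, mirror images and angle bisectors *)

Lemma perp_bisectorNl P Q : P <> Q -> P \notin perp_bisector P Q.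
Proof.
move=> /eqP PQ; apply/negP=> /line_dirP[t E].
have : ((2^-1)%:C + t%:C * 'i) * (Q - P) = 0 :> C.
  transitivity ((P + Q) / 2 + t%:C * ('i * (Q - P)) - P).
    by rewrite complexC_half; field.
  by rewrite -E subrr.
move/eqP; rewrite mulf_eq0 subr_eq0 [Q == P]eq_sym (negPf PQ) orbF.
by move/eqP/complexC_eq0 => -[/eqP]; rewrite invr_eq0 pnatr_eq0.
Qed.

(** A homothety centred at a point of the mirror preserves the mirror, so it commutes with the
    reflection. Negative ratios matter: the point folded later may lie beyond the vertex of the
    angle. *)
Lemma mirror_image_scale b A X Y s : s != 0 -> A \in b -> mirror_image b X Y ->
  mirror_image b (A + s%:C * (X - A)) (A + s%:C * (Y - A)).
Proof.
move=> s0 Ab [bl [[-> Xb]|[YX bE]]]; split=> //.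
  left; split=> //; have [d d0 bE] := is_line_rebase bl Ab.
  move: Xb; rewrite bE => /line_dirP[t ->]; apply/line_dirP.
  by exists (s * t); ring.
right; split.
  move=> /addrI /mulfI H; apply: YX; apply: (@addIr _ (- A)); apply: H.
  by rewrite eq_complex /= eqxx andbT.
move: Ab; rewrite bE => Ab; rewrite /perp_bisector -(line_dir_rebase Ab).
case/line_dirP: Ab => t At.
set P := A + _ * (X - A); set P' := A + _ * (Y - A).
have PE : P' - P = s%:C * (Y - X) by rewrite /P /P'; ring.
rewrite PE mulrCA line_dirZ //.
(* The homothety fixes [A] and sends the midpoint of [X], [Y] to that of [P], [P']; the offset [t]
   from midpoint to [A] becomes [s * t]. *)
have AP : A \in line_dir ((P + P') / 2) ('i * (Y - X)).
  apply/line_dirP; exists (s * t).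
  transitivity (A + s%:C * ((X + Y) / 2 + t%:C * ('i * (Y - X)) - A)).
    by rewrite -At subrr mulr0 addr0.
  by rewrite /P /P'; field.
by rewrite (line_dir_rebase AP).
Qed.

Lemma mirror_image_vertex b A Y : A \in b -> mirror_image b A Y -> Y = A.
Proof.
move=> Ab [_ [[]//|[YA bE]]]; move: Ab; rewrite bE.
by move/negP: (perp_bisectorNl (not_eq_sym YA)).
Qed.

(** [C'] is the mirror image of some [X] on the first arm. Since [P] is the image of [X] under a
    homothety centred at [A], its mirror image is the corresponding multiple of [C'], which stays on
    [m]. *)
Lemma fold_line_bisects l m b A B C' P : is_line l -> is_line m ->
  A \in l -> A \in m -> B \in l -> C' \in m -> B <> A -> C' <> A ->
  bisects b B A C' -> P \in l -> P <> A -> fold_line m P A b.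
Proof.
move=> ll ml Al Am Bl Cm BA CA [bl Ab bE] Pl PA; split=> //; first by case.
have : ray A C' C' by exists 1 => /=; [exact: ler01|ring].
rewrite -bE => -[X /set_mem[t _ XE] bX].
have XA : X <> A by move=> XA; apply: CA; apply: mirror_image_vertex Ab _; rewrite -XA.
have Xl : X \in l.
  by rewrite (is_line_eq ll Al Bl BA); apply/line_dirP; exists t.
move: Pl; rewrite (is_line_eq ll Al Xl XA) => /line_dirP[s PE].
have s0 : s != 0 by apply/eqP=> s0; apply: PA; rewrite PE s0 mul0r addr0.
exists (A + s%:C * (C' - A)); split.
  by rewrite PE; exact: mirror_image_scale.
by rewrite (is_line_eq ml Am Cm CA); apply/line_dirP; exists s.
Qed.

(** * Lines at 30 degrees to a segment *)

(* For [k = ± sqrt 3 / 2], the number [k + i/2] has modulus 1 and argument 30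
   or 150 degrees. *)
Definition tilted_line k P Q := line_dir Q ((k%:C + 'i / 2) * (P - Q)).

Lemma tilted_dir_neq0 k : k%:C + 'i / 2 != 0 :> C.
Proof.
apply/eqP; rewrite [_ / 2]mulrC -complexC_half.
by move/complexC_eq0 => -[_ /eqP]; rewrite invr_eq0 pnatr_eq0.
Qed.

Lemma fold_line_tilted k P Q : k ^+ 2 = 3 / 4 -> P <> Q ->
  fold_line (perp_bisector P Q) P Q (tilted_line k P Q).
Proof.
move=> k2 /eqP PQ.
have kk : k%:C * k%:C = 3 / 4 :> C.
  by rewrite -rmorphM /= -expr2 k2 rmorphM fmorphV !rmorph_nat.
have PQ0 : P - Q != 0 by rewrite subr_eq0.
have tl : is_line (tilted_line k P Q).
  by apply: is_line_dir; rewrite mulf_neq0 ?tilted_dir_neq0.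
split=> //; first by case=> E; move: PQ; rewrite E eqxx.
  exact: line_dir_base.
(* The factor is a primitive sixth root of unity, so [P'] is the apex of an equilateral triangle on
   [P], [Q]. *)
pose P' := Q + (1 / 2 + k%:C * 'i) * (P - Q).
have dE : 'i * (P' - P) = (-1)%:C * ((k%:C + 'i / 2) * (P - Q)).
  rewrite /P' rmorphN rmorph1.
  transitivity ((k%:C * ('i * 'i) - 'i / 2) * (P - Q)); first by field.
  by rewrite mulii; field.
exists P'; split.
  split=> //; right; split.
    move=> E; move: dE; rewrite E subrr mulr0 => /esym/eqP.
    rewrite !mulf_eq0 (negPf PQ0) (negPf (tilted_dir_neq0 k)) /=.
    by rewrite rmorphN rmorph1 oppr_eq0 oner_eq0.
  (* [Q] is equidistant from [P] and [P']; this is where the value of [k ^+ 2] enters. *)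
  have Qb : Q \in perp_bisector P P'.
    apply/line_dirP; exists k; rewrite dE rmorphN rmorph1 /P'.
    transitivity (Q + (3 / 4 - k%:C * k%:C) * (P - Q)); last by field.
    by rewrite kk subrr mul0r addr0.
  rewrite /perp_bisector -(line_dir_rebase Qb) dE line_dirZ //.
  by rewrite oppr_eq0 oner_eq0.
by apply/line_dirP; exists (- k); rewrite /P'; field.
Qed.

(** The number [k + i/2] is not real, so no real multiple of it equals 1. *)
Lemma tilted_lineN k P Q : P <> Q -> P \notin tilted_line k P Q.
Proof.
move=> /eqP PQ; apply/negP => /line_dirP[t E].
have : (1 - t%:C * (k%:C + 'i / 2)) * (P - Q) = 0.
  transitivity (P - (Q + t%:C * ((k%:C + 'i / 2) * (P - Q)))); first by field.
  by rewrite -E subrr.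
move/eqP; rewrite mulf_eq0 [P - Q == 0]subr_eq0 (negPf PQ) orbF => /eqP H.
have [|t1 t0] := @complexC_eq0 (1 - t * k) (- (t / 2)).
  by rewrite -[RHS]H rmorphB rmorphN !rmorphM /= complexC_half rmorph1; field.
have : 1 = 1 - t * k - 2 * k * (- (t / 2)) by field.
by rewrite t1 t0 mulr0 subrr => /eqP; rewrite oner_eq0.
Qed.

Lemma tilted_line_meets A D d : D <> A -> d != 0 ->
  exists k X, [/\ k ^+ 2 = 3 / 4, X \in line_dir A d,
                  X \in tilted_line k A D & X <> A].
Proof.
(* Coordinates are taken with [A - D] as unit: [d] becomes [x + iy]. *)
move=> /eqP DA d0; have AD0 : A - D != 0 by rewrite subr_eq0 eq_sym.
have [x [y dE]] : exists x y, d = (x%:C + y%:C * 'i) * (A - D).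
  case E: (d / (A - D)) => [x y]; exists x, y.
  by rewrite -[LHS](divfK AD0) E; congr (_ * _); simpc.
have k2 : (Num.sqrt (3 / 4 : R)) ^+ 2 = 3 / 4.
  by rewrite sqr_sqrtr // divr_ge0.
(* Up to a factor, [2 * y * k - x] is the determinant of [(x, y)] and [(k, 1/2)], so it vanishes
   exactly when the lines are parallel. Vanishing for both signs of [k] would force [d = 0]. *)
have [k [kE nk]] : exists k, k ^+ 2 = 3 / 4 /\ 2 * y * k - x != 0.
  set r := Num.sqrt _ in k2.
  have [E|] := eqVneq (2 * y * r - x) 0; last by exists r.
  exists (- r); rewrite sqrrN; split=> //; apply/eqP=> E'.
  have r0 : r != 0 by apply/eqP=> r0; move/eqP: k2;
    rewrite r0 expr0n /= eq_sym mulf_eq0 invr_eq0 !pnatr_eq0.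
  have x0 : x = 0.
    have -> : x = - ((2 * y * r - x) + (2 * y * - r - x)) / 2 by field.
    by rewrite E E' addr0 oppr0 mul0r.
  have y0 : y = 0.
    by move/eqP: E; rewrite x0 subr0 !mulf_eq0 (negPf r0) pnatr_eq0 orbF /= => /eqP.
  by move: d0; rewrite dE x0 y0 mul0r addr0 mul0r eqxx.
(* With origin [D], the intersection satisfies [1 + s x = u k] and [s y = u / 2]; eliminating [u]
   gives this [s]. As it is nonzero, the intersection differs from [A]. *)
pose s := (2 * y * k - x)^-1.
have sE : s%:C * x%:C = 2 * s%:C * y%:C * k%:C - 1 :> C.
  have E : s * x = 2 * s * y * k - 1 by rewrite /s; field.
  by rewrite -rmorphM /= E rmorphB !rmorphM rmorph_nat rmorph1.
have X0 : s%:C * d != 0.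
  by rewrite mulf_neq0 // eq_complex /= eqxx andbT invr_eq0.
exists k, (A + s%:C * d); split=> //.
- by apply/line_dirP; exists s.
- apply/line_dirP; exists (2 * s * y).
  transitivity (A + (s%:C * x%:C + s%:C * y%:C * 'i) * (A - D)).
    by rewrite dE; ring.
  by rewrite sE !rmorphM rmorph_nat; field.
- by move/eqP; rewrite -subr_eq0 addrAC subrr add0r (negPf X0).
Qed.

(** * Sets of points and lines closed under the three axioms *)

Section Closed.
Variables (S : set C) (L : set (set C)).
Hypothesis L_line : forall l, l \in L -> is_line l.
Hypotheses (alphaSL : axiom_alpha S L) (betaSL : axiom_beta S L).
Hypothesis gammaSL : axiom_gamma S L.

Lemma tilted_line_closed k P Q : k ^+ 2 = 3 / 4 -> P \in S -> Q \in S ->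
  P <> Q -> tilted_line k P Q \in L.
Proof.
move=> k2 PS QS PQ; apply: (gammaSL (betaSL PS QS PQ) PS QS).
exact: fold_line_tilted.
Qed.

Lemma line_through_closed P Q : P \in S -> Q \in S -> P <> Q ->
  line_through P Q \in L.
Proof.
move=> PS QS PQ.
have k2 : (Num.sqrt (3 / 4 : R)) ^+ 2 = 3 / 4 by rewrite sqr_sqrtr // divr_ge0.
have tL := tilted_line_closed k2 PS QS PQ.
have tl := is_line_through PQ.
apply: (gammaSL tL QS PS); split=> //.
- by case=> /esym.
- exact: line_dir_base.
(* The fold is degenerate: [Q] is its own mirror image in the line joining [P] and [Q], and it
   already lies on the tilted line. *)
- exists Q; split; last exact: line_dir_base.
  split=> //; left; split=> //; apply/line_dirP; exists 1.
  by rewrite rmorph1; ring.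
Qed.

(** The points selecting the arms of an angle need not lie in [S]; this supplies a point of [S] on
    an arm's line that can be folded instead. *)
Lemma second_point_closed l A D : l \in L -> A \in S -> D \in S -> D <> A ->
  A \in l -> exists2 P, P \in S & P \in l /\ P <> A.
Proof.
move=> lL AS DS DA Al.
have [d d0 lE] := is_line_rebase (L_line lL) Al.
have [k [X [k2 Xl Xt XA]]] := tilted_line_meets DA d0.
have AD := not_eq_sym DA.
exists X; last by rewrite lE.
apply: (alphaSL lL (tilted_line_closed k2 AS DS AD)); split=> //.
  (* The two lines are distinct because [A] lies on [l] but not on the tilted line. *)
  by move=> E; move: (tilted_lineN k AD); rewrite -E Al.
by rewrite lE.
Qed.

Lemma euclid_sub_closed : 0 \in S -> 1 \in S ->
  (forall P, euclid_point P -> P \in S) /\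
  (forall l, euclid_line l -> l \in L).
Proof.
move=> S0 S1; apply: euclid_mind => //.
- by move=> l m P _ lL _ mL; exact: alphaSL.
- by move=> P Q _ PS _ QS; exact: line_through_closed.
- by move=> P Q _ PS _ QS; exact: betaSL.
- move=> l m b A B C' _ lL _ mL _ AS Al Am Bl Cm BA CA bis.
  (* One of 0 and 1 differs from the vertex. *)
  have [D DS DA] : exists2 D, D \in S & D <> A.
    have [<-|/eqP A0] := eqVneq 0 A; last by exists 0.
    by exists 1 => //; apply/eqP; exact: oner_neq0.
  have [P PS [Pl PA]] := second_point_closed lL AS DS DA Al.
  apply: (gammaSL mL PS AS).
  exact: (fold_line_bisects (L_line lL) (L_line mL) Al Am Bl Cm).
- by move=> l m P Q _ lL _ PS _ QS; exact: gammaSL.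
Qed.

End Closed.

(** * Closure of the Euclidean numbers and their minimality *)

Lemma euclid_line_is_line l : euclid_line l -> is_line l.
Proof.
case=> {l}.
- by move=> P Q _ _ /is_line_through.
- by move=> P Q _ _ /is_line_perp_bisector.
- by move=> l m b A B C' _ _ _ _ _ _ _ _ _ [].
- by move=> l m P Q _ _ _ [].
Qed.

Lemma Euclidean_numbers_closed : closed_alpha_beta_gamma (Euclidean_numbers R).
Proof.
exists [set l | euclid_line l]; split.
- by move=> l; rewrite in_setE; exact: euclid_line_is_line.
- move=> l m P; rewrite !in_setE; exact: euclid_coincidence.
- move=> P Q; rewrite !in_setE; exact: euclid_perp_bisector.
- move=> l P Q m; rewrite !in_setE; exact: euclid_fold.
Qed.

End Lines.

Theorem theorem4p2 (R : realType) :
  let E := Euclidean_numbers R in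
  [/\ 0 \in E, 1 \in E & closed_alpha_beta_gamma E] /\
  (forall S : set (complex R),
     0 \in S -> 1 \in S -> closed_alpha_beta_gamma S -> E `<=` S).
Proof.
split.
  split; [rewrite in_setE; exact: euclid_0 | rewrite in_setE; exact: euclid_1 |].
  exact: Euclidean_numbers_closed.
move=> S S0 S1 [L [Ll La Lb Lg]] P EP; apply: set_mem.
by have [+ _] := euclid_sub_closed Ll La Lb Lg S0 S1; apply.
Qed.
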